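(* Let $\mathbb{K}$ be $\mathbb{R}$ or $\mathbb{C}$, let $n\geq 1$, and let $A\subset\mathbb{K}^n$ be a puck. Then $A$ is an ellipsoid in $\mathbb{K}^n$ if and only if for every line $\ell$ of $\mathbb{K}^n$ there is a hyperplane of $\mathbb{K}^n$ that contains the centers of all nonempty intersections of $A$ with lines parallel to $\ell$.
   Context: A line of $\mathbb{K}^n$ is a $\mathbb{K}$-affine subspace of dimension $1$ over $\mathbb{K}$, and a hyperplane of $\mathbb{K}^n$ is a $\mathbb{K}$-affine subspace of codimension $1$ over $\mathbb{K}$ (so for $\mathbb{K}=\mathbb{C}$ these are complex lines and complex hyperplanes). Lines parallel to $\ell$ are the translates of $\ell$, including $\ell$ itself. A subset of $\mathbb{K}^n$ is symmetric with center $\mathbf{c}$ if it is a translate by $\mathbf{c}$ of a set invariant under multiplication by every scalar $\zeta\in\mathbb{K}$ with $|\zeta|=1$. Convexity in $\mathbb{C}^n$ is real convexity, inherited from $\mathbb{C}^n=\mathbb{R}^{2n}$. A compact set is non-flat if it is not contained in a real affine hyperplane (of $\mathbb{R}^n$, respectively of $\mathbb{R}^{2n}=\mathbb{C}^n$), i.e. if its convex hull has nonempty interior. A puck in $\mathbb{K}^n$ is a non-flat compact subset $A$ of $\mathbb{K}^n$ such that every nonempty intersection of $A$ with a line of $\mathbb{K}^n$ is convex and symmetric; that is, each such intersection is a closed segment if $\mathbb{K}=\mathbb{R}$, and a closed round disk if $\mathbb{K}=\mathbb{C}$ (in both cases possibly degenerate to a single point). The center of such an intersection is its center of symmetry (the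 midpoint of the segment, respectively the center of the disk). An ellipsoid in $\mathbb{K}^n$ is any translate (by a vector of $\mathbb{K}^n$) of a set $\{\mathbf{x}\in\mathbb{K}^n : \mathbf{x}^{T}M\overline{\mathbf{x}}\leq 1\}$, where $M$ is an $n\times n$ positive definite Hermitian matrix over $\mathbb{K}$ (symmetric if $\mathbb{K}=\mathbb{R}$). *)

(* Defs.v *)
From mathcomp Require Export all_boot all_order all_algebra.
From mathcomp Require Export sesquilinear.
From mathcomp Require Export complex.
From mathcomp Require Export all_classical all_reals all_analysis.

Set Implicit Arguments.
Unset Strict Implicit.
Unset Printing Implicit Defensive.

Export Order.TTheory GRing.Theory Num.Theory.
Export numFieldNormedType.Exports.

Local Open Scope classical_set_scope.
Local Open Scope ring_scope.

(* Points of K^n are row vectors; K is meant to be a realType R or R[i].      *)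

Section AffineSubspaces.
Variables (K : fieldType) (n : nat).
Implicit Types (V : {vspace 'rV[K]_n}) (X Y : set 'rV[K]_n).

Definition translate (u : 'rV[K]_n) X : set 'rV[K]_n := [set u + x | x in X].

Definition line X := exists p V, \dim V = 1%N /\ X = translate p [set` V].

Definition hyperplane X :=
  exists p V, (\dim V).+1 = n /\ X = translate p [set` V].

Definition parallel X Y := exists u, Y = translate u X.

Definition flat X := exists2 H, hyperplane H & X `<=` H.

End AffineSubspaces.

Section Sections.
Variables (K : numFieldType) (n : nat).
Implicit Types A X : set 'rV[K]_n.

Definition unit_invariant X :=
  forall z : K, `|z| = 1 -> [set z *: x | x in X] = X.

Definition symmetric_at (c : 'rV[K]_n) X :=
  exists2 Y, unit_invariant Y & X = translate c Y.

(* [convex_set] takes its weights among the t : K with 0 <= t <= 1; in R[i]   *)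
(* these inequalities force t to be real, so this is real convexity in C^n.   *)
Definition round_sections A := forall l, line l -> A `&` l !=set0 ->
  convex_set (A `&` l) /\ exists c, symmetric_at c (A `&` l).

Definition section_centers A l : set 'rV[K]_n :=
  [set c | exists m, [/\ parallel l m, A `&` m !=set0 & symmetric_at c (A `&` m)]].

Definition hyperplanar_centers A :=
  forall l, line l -> exists2 H, hyperplane H & section_centers A l `<=` H.

(* [form theta M x x] is x M theta(x)^T, i.e. v^T M theta(v) for the column   *)
(* vector v = x^T; theta is the conjugation of K (the identity when K is      *)
(* real). For K = R[i], 0 < z and z <= 1 both include that z is real.         *)
Definition ellipsoid (theta : {rmorphism K -> K}) A :=
  exists (M : 'M[K]_n) (c : 'rV[K]_n),
    [/\ M \is hermitianmx n false theta,
        forall x : 'rV[K]_n, x != 0 -> 0 < form theta M x x &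
        A = translate c [set x | form theta M x x <= 1]].

End Sections.

Section Pucks.
Variables (R : realType) (n : nat).

Definition real_coords (x : 'rV[R[i]]_n) : 'rV[R]_(n + n) :=
  row_mx (map_mx (@complex.Re R) x) (map_mx (@complex.Im R) x).

Definition real_puck (A : set 'rV[R]_n) :=
  [/\ compact A, ~ flat A & round_sections A].

(* Non-flatness refers to real hyperplanes of C^n = R^(2n), whereas the lines *)
(* in [round_sections] are complex lines. R[i] gets its topology as a         *)
(* numFieldType, hence the cast.                                              *)
Definition complex_puck (A : set 'rV[R[i]]_n) :=
  [/\ @compact 'rV[(R[i] : numFieldType)]_n A,
      ~ flat [set real_coords x | x in A] & round_sections A].

End Pucks.

(* Main.v *)
Require Import Defs.
From mathcomp Require Import spectral ring lra.

Set Implicit Arguments.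
Unset Strict Implicit.
Unset Printing Implicit Defensive.

Local Open Scope classical_set_scope.
Local Open Scope ring_scope.

(** Suppose first that the centers of the sections in each direction lie in a
    hyperplane. For a direction [v] let [H] be this hyperplane. It cannot be
    parallel to [v], for then every point of [A] would lie in [H], against
    non-flatness. Multiplying the component along [v] by a scalar [z] of
    modulus 1 and fixing [H] pointwise therefore defines an affine map, which
    rotates each section of direction [v] about its center and hence preserves
    [A] ([section_reflection]). So [A] has an affine complex reflection in
    every direction. Two facts finish the argument.

    - All these reflections are isometries, with a common fixed point, of one
      Euclidean structure. This is the Loewner ellipsoid argument, carried out
      over the reals: among the positive semidefinite quadratic forms [Q] on
      the space of homogeneous coordinates [(1, x)] that are at most 1 on [A],
      one maximizes the determinant ([loewner_exists]). As the determinant is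
      strictly log-concave ([symmetric_det_midpoint_eq]), the maximizer is
      unique, so every affine automorphism of [A] preserves it; working with
      homogeneous coordinates yields the center and the quadratic form at once
      ([invariant_ellipsoid]). In the complex case this is applied to the
      image of [A] in R^(2n). The real form obtained there is invariant under
      multiplication by unit scalars, because the linear part of the
      reflection of direction [v] maps [v] to [z *: v]; so it is the quadratic
      form of a Hermitian matrix ([complex_form_of_real]).

    - If every direction has a reflection, then the reflections act
      transitively on spheres: for [x] and [y] of the same norm, the reflection
      of direction [x - y], with a suitable [z], maps [x] to [y]. Since [A] is
      convex and compact, it is the ball whose radius is the largest distance
      of a point of [A] to the center ([ellipsoid_of_reflections]).

    Conversely, in an ellipsoid of center [c] the orthogonal projection of [c]
    on a line is the only possible center of the section by this line, so that
    the centers for the direction [v] lie in the hyperplane orthogonal to [v]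
    through [c] ([hyperplanar_centers_of_ellipsoid]).

    The algebra common to both cases is done over a field [K] with an
    endomorphism [theta] such that [t * theta t = `|t| ^+ 2] and with square
    roots of nonnegative elements. *)

(** * Strict log-concavity of the determinant *)

Section DeterminantConcavity.
Local Open Scope sesquilinear_scope.
Variable C : numClosedFieldType.

Definition hermitian_posdef n (S : 'M[C]_n) := S ^t Num.conj = S /\
  forall x : 'rV[C]_n, x != 0 -> 0 < (x *m S *m x ^t Num.conj) 0 0.

Lemma hermitian_posdef_diag n (S : 'M[C]_n) : hermitian_posdef S ->
  exists (U : 'M[C]_n) (d : 'rV[C]_n),
    [/\ U *m U ^t Num.conj = 1%:M, U *m S *m U ^t Num.conj = diag_mx d
      & forall i, 0 < d 0 i].
Proof.
move=> [Sh Spos].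
have /hermitian_normalmx /orthomx_spectralP SE : S \is hermsymmx.
  by apply/is_hermitianmxP; rewrite expr0 scale1r Sh.
set U := spectralmx S in SE; set d := spectral_diag S in SE.
have Uu : U *m U ^t Num.conj = 1%:M by apply/unitarymxP; exact: spectral_unitarymx.
have UV : invmx U = U ^t Num.conj by apply: invmx_unitary; exact: spectral_unitarymx.
have UD : U *m S *m U ^t Num.conj = diag_mx d.
  by rewrite {1}SE UV !mulmxA Uu mul1mx -mulmxA Uu mulmx1.
exists U, d; split=> // i.
have rowM (T : 'M[C]_n) : (row i U *m T *m (row i U) ^t Num.conj) 0 0 =
    (U *m T *m U ^t Num.conj) i i.
  by rewrite tr_row map_col -!row_mul colE mulmxA -colE !mxE.
have /Spos : row i U != 0.
  apply/eqP => r0; have := rowM 1%:M.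
  by rewrite r0 mul0mx mul0mx mulmx1 Uu !mxE eqxx => /eqP; rewrite eq_sym oner_eq0.
by rewrite rowM UD !mxE eqxx mulr1n.
Qed.

(** First [P] is brought to the identity by rescaling an orthonormal eigenbasis,
    then the transform of [Q] is diagonalized by a unitary matrix, which leaves
    the identity unchanged. *)
Lemma simultaneous_diag n (P Q : 'M[C]_n) :
  hermitian_posdef P -> hermitian_posdef Q ->
  exists (B : 'M[C]_n) (e : 'rV[C]_n),
    [/\ B *m P *m B ^t Num.conj = 1%:M, B *m Q *m B ^t Num.conj = diag_mx e
      & forall i, 0 < e 0 i].
Proof.
move=> Ppd [Qh Qpos].
have [U [d [Uu UP dpos]]] := hermitian_posdef_diag Ppd.
pose s : 'rV[C]_n := \row_i (sqrtC (d 0 i))^-1.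
have sh : (diag_mx s) ^t Num.conj = diag_mx s.
  rewrite tr_diag_mx map_diag_mx; congr diag_mx; apply/rowP => i; rewrite !mxE.
  by apply: geC0_conj; rewrite invr_ge0 sqrtC_ge0 ltW.
pose B := diag_mx s *m U.
have BP : B *m P *m B ^t Num.conj = 1%:M.
  rewrite /B trmx_mul map_mxM sh !mulmxA -(mulmxA _ U) -(mulmxA _ (U *m P)) UP.
  rewrite !mulmx_diag; apply/matrixP => i j; rewrite !mxE.
  case: eqP => [_|//]; rewrite !mulr1n -{2}(sqrtCK (d 0 i)).
  have h : sqrtC (d 0 i) != 0 by rewrite sqrtC_eq0 gt_eqF.
  by field.
clearbody B.
have trC (M : 'M[C]_n) : (M ^t Num.conj) ^t Num.conj = M.
  by rewrite map_trmx trmxK -map_mx_comp map_mx_id //; exact: conjCK.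
have BU : B \in unitmx by move: BP; rewrite -mulmxA => /mulmx1_unit[].
have Qpd : hermitian_posdef (B *m Q *m B ^t Num.conj).
  split=> [|x x0].
    by rewrite !trmx_mul !map_mxM trC Qh mulmxA.
  have -> : x *m (B *m Q *m B ^t Num.conj) *m x ^t Num.conj =
      (x *m B) *m Q *m (x *m B) ^t Num.conj.
    by rewrite trmx_mul map_mxM !mulmxA.
  apply: Qpos; apply: contra_neq x0 => xB0.
  by rewrite -[x](mulmxK BU) xB0 mul0mx.
have [V [e [Vu VQ epos]]] := hermitian_posdef_diag Qpd.
exists (V *m B), e; rewrite trmx_mul map_mxM; split=> //; last first.
  by rewrite -VQ !mulmxA.
by rewrite !mulmxA -(mulmxA V) -(mulmxA V) BP mulmx1.
Qed.

(** After simultaneous diagonalization this is the inequality between the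
    arithmetic and geometric means of 1 and each eigenvalue [e] of [Q] relative
    to [P]: [4 * e <= (1 + e) ^+ 2], with equality only for [e = 1], while the
    eigenvalues have product 1. The midpoint is doubled to avoid denominators,
    whence the factor [2 ^+ n]. *)
Lemma hermitian_det_midpoint_eq n (P Q : 'M[C]_n) :
  hermitian_posdef P -> hermitian_posdef Q -> \det P = \det Q ->
  \det (P + Q) <= 2 ^+ n * \det P -> P = Q.
Proof.
move=> Ppd Qpd dPQ dle.
have [B [e [BP BQ epos]]] := simultaneous_diag Ppd Qpd.
have BU : B \in unitmx by move: BP; rewrite -mulmxA => /mulmx1_unit[].
pose b := \det B * (\det B)^*.
have detB M : \det (B *m M *m B ^t Num.conj) = b * \det M.
  by rewrite !det_mulmx det_map_mx det_tr /b mulrAC.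
have b0 : 0 <= b by rewrite /b mul_conjC_ge0.
have bP : b * \det P = 1 by rewrite -detB BP det1.
have bQ : \prod_i e 0 i = 1 by rewrite -det_diag -BQ detB -dPQ.
have bPQ : \prod_i (1 + e 0 i) <= 2 ^+ n.
  have -> : \prod_i (1 + e 0 i) = b * \det (P + Q).
    rewrite -detB mulmxDr mulmxDl BP BQ -diag_const_mx -raddfD det_diag.
    by apply: eq_bigr => i _; rewrite !mxE.
  by apply: le_trans (ler_wpM2l b0 dle) _; rewrite mulrCA bP mulr1.
suff e1 : e = const_mx 1.
  have BPQ : B *m P *m B ^t Num.conj = B *m Q *m B ^t Num.conj.
    by rewrite BP BQ e1 diag_const_mx.
  have BhU : B ^t Num.conj \in unitmx by rewrite map_unitmx unitmx_tr.
  by have /(can_inj (mulKmx BU)) := can_inj (mulmxK BhU) BPQ.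
apply/rowP => i; rewrite !mxE; apply/eqP/negP => /negP ei.
have amgm j : 4 * e 0 j <= (1 + e 0 j) ^+ 2.
  rewrite -subr_ge0 [leRHS](_ : _ = (1 - e 0 j) ^+ 2); last by ring.
  by apply: real_exprn_even_ge0 => //; rewrite rpredB ?real1 ?gtr0_real.
have amgmi : 4 * e 0 i < (1 + e 0 i) ^+ 2.
  rewrite lt_neqAle amgm andbT; apply: contra ei => /eqP h.
  have : (e 0 i - 1) ^+ 2 = 0.
    have -> : (e 0 i - 1) ^+ 2 = (1 + e 0 i) ^+ 2 - 4 * e 0 i by ring.
    by rewrite h subrr.
  by move/eqP; rewrite sqrf_eq0 subr_eq0.
have lt4 : \prod_j (4 * e 0 j) < \prod_j (1 + e 0 j) ^+ 2.
  rewrite (bigD1 i) //= [ltRHS](bigD1 i) //=.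
  apply: (@lt_le_trans _ _ ((1 + e 0 i) ^+ 2 * \prod_(j | j != i) (4 * e 0 j))).
    by rewrite ltr_pM2r // prodr_gt0 // => j _; rewrite mulr_gt0.
  rewrite ler_wpM2l //; first by rewrite exprn_ge0 // addr_ge0 // ltW.
  by apply: ler_prod => j _; rewrite amgm andbT mulr_ge0 // ltW.
have : \prod_j (1 + e 0 j) ^+ 2 <= 4 ^+ n.
  rewrite prodrXl (_ : 4 = 2 ^+ 2); last by ring.
  rewrite exprAC lerXn2r // nnegrE ?exprn_ge0 //.
  by apply: prodr_ge0 => j _; rewrite addr_ge0 // ltW.
move/(lt_le_trans lt4); rewrite big_split /= bQ mulr1 prodr_const card_ord.
by rewrite ltxx.
Qed.
End DeterminantConcavity.

(** * Real forms and Hermitian forms *)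

Lemma mx11_tr (K : Type) (X : 'M[K]_1) : X^T = X.
Proof. by apply/matrixP => i j; rewrite mxE !ord1. Qed.

Lemma sym_formC (R : comNzRingType) n (P : 'M[R]_n) (a b : 'rV[R]_n) : P^T = P ->
  a *m P *m b^T = b *m P *m a^T.
Proof. by move=> PT; rewrite -[LHS]mx11_tr !trmx_mul trmxK PT mulmxA. Qed.

Section RealForms.
Local Open Scope sesquilinear_scope.
Local Open Scope complex_scope.
Variable R : rcfType.
Local Notation rc := (real_complex R).

Definition symmetric_posdef n (P : 'M[R]_n) := P^T = P /\
  forall x : 'rV[R]_n, x != 0 -> 0 < (x *m P *m x^T) 0 0.

Lemma skew_formC n (Q : 'M[R]_n) (a b : 'rV[R]_n) : Q^T = - Q ->
  a *m Q *m b^T = - (b *m Q *m a^T).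
Proof. by move=> PT; rewrite -[LHS]mx11_tr !trmx_mul trmxK PT mulmxA mulmxN mulNmx. Qed.

Lemma skew_form0 n (Q : 'M[R]_n) (a : 'rV[R]_n) : Q^T = - Q ->
  a *m Q *m a^T = 0.
Proof.
move=> QT; have /eqP := skew_formC a a QT.
rewrite -subr_eq0 opprK -mulr2n -scaler_nat scalemx_eq0 pnatr_eq0 /=.
by move/eqP.
Qed.

(** The expansion of [z H z^*] for [z = a + u b] and [H = P + u Q] with
    [u ^+ 2 = -1]. The imaginary part cancels because [P] is symmetric and [Q]
    is skew. Abstracting the complex numbers to a ring containing such a [u]
    keeps the computation purely formal. *)
Lemma adjoin_i_form (C : comNzRingType) (f : {rmorphism R -> C}) (u : C) n
    (P Q : 'M[R]_n) (a b : 'rV[R]_n) :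
  u ^+ 2 = - 1 -> P^T = P -> Q^T = - Q ->
  (map_mx f a + u *: map_mx f b) *m (map_mx f P + u *: map_mx f Q) *m
    (map_mx f a^T - u *: map_mx f b^T) =
  map_mx f (a *m P *m a^T + b *m P *m b^T + 2 *: (a *m Q *m b^T)).
Proof.
move=> u2 PT QT.
rewrite !(mulmxDl, mulmxDr, mulmxN, mulNmx) -!(scalemxAl, scalemxAr) -!map_mxM.
rewrite (sym_formC b a PT) !(skew_form0 _ QT) (skew_formC b a QT).
move: (a *m P *m a^T) (a *m P *m b^T) (b *m P *m b^T) (a *m Q *m b^T).
move=> X Y Z W; apply/matrixP => j k.
rewrite !mxE !rmorphD !rmorphM !rmorphN rmorph0 rmorph_nat /=.
ring: u2.
Qed.

Lemma complex_rowE n (z : 'rV[R[i]]_n) :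
  z = map_mx rc (map_mx (@complex.Re R) z) + 'i *: map_mx rc (map_mx (@complex.Im R) z).
Proof. by apply/rowP => j; rewrite !mxE; case: (z 0 j) => x y /=; simpc. Qed.

(** Used with [Q = 0] to extend a real positive definite form to complex
    vectors, and with general [Q] to recognize a real form that is invariant
    under multiplication by [i] as a Hermitian one. *)
Lemma hermitian_form_split n (P Q : 'M[R]_n) (z : 'rV[R[i]]_n) :
  let a := map_mx (@complex.Re R) z in let b := map_mx (@complex.Im R) z in
  P^T = P -> Q^T = - Q ->
  z *m (map_mx rc P + 'i *: map_mx rc Q) *m z ^t Num.conj =
  map_mx rc (a *m P *m a^T + b *m P *m b^T + 2 *: (a *m Q *m b^T)).
Proof.
move=> a b PT QT.
rewrite -(@adjoin_i_form _ _ 'i) ?sqrCi //.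
have -> : z ^t Num.conj = map_mx rc a^T - 'i *: map_mx rc b^T.
  by apply/matrixP => j k; rewrite !mxE; case: (z _ _) => x y /=; simpc.
by rewrite [in LHS](complex_rowE z).
Qed.

Lemma symmetric_posdefC n (P : 'M[R]_n) :
  symmetric_posdef P -> hermitian_posdef (map_mx rc P).
Proof.
move=> [PT Ppos]; split=> [|z z0].
  rewrite map_trmx PT -map_mx_comp; apply: eq_map_mx => x /=.
  exact: conjc_real.
have := @hermitian_form_split n P 0 z PT; rewrite trmx0 oppr0 => /(_ erefl).
rewrite map_mx0 scaler0 addr0 mulmx0 mul0mx scaler0 addr0 => ->.
rewrite mxE ltcR mxE.
have Pge0 (x : 'rV[R]_n) : 0 <= (x *m P *m x^T) 0 0.
  have [->|/Ppos/ltW//] := eqVneq x 0; by rewrite mul0mx mul0mx mxE.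
have [a0|/Ppos a0] := eqVneq (map_mx (@complex.Re R) z) 0; last first.
  exact: ltr_wpDr.
have [b0|/Ppos b0] := eqVneq (map_mx (@complex.Im R) z) 0; last first.
  exact: ltr_wpDl.
by case/eqP: z0; rewrite (complex_rowE z) a0 b0 !map_mx0 scaler0 addr0.
Qed.

(** The real statement is deduced from the complex one so as to use the
    spectral theorem of Hermitian matrices. *)
Lemma symmetric_det_midpoint_eq n (P Q : 'M[R]_n) :
  symmetric_posdef P -> symmetric_posdef Q -> \det P = \det Q ->
  \det (P + Q) <= 2 ^+ n * \det P -> P = Q.
Proof.
move=> /symmetric_posdefC Ppd /symmetric_posdefC Qpd dPQ dle.
apply: (map_mx_inj (f := rc)) (hermitian_det_midpoint_eq Ppd Qpd _ _).
  by rewrite !det_map_mx dPQ.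
rewrite -map_mxD !det_map_mx -(rmorph_nat rc) -rmorphXn -rmorphM.
by rewrite lecR.
Qed.
End RealForms.

(** * Hyperplanes, lines and flat sets *)

Section Hyperplanes.
Variables (K : fieldType) (n : nat).

Lemma hyperplane_level (phi : 'cV[K]_n) (s : K) : phi != 0 ->
  hyperplane [set x : 'rV[K]_n | (x *m phi) 0 0 = s].
Proof.
move=> phi0.
have [j phij] : exists j, phi j 0 != 0.
  by apply/existsP; apply: contraNT phi0 => /existsPn h; apply/eqP/colP => j;
    rewrite mxE; apply/eqP; move: (h j); rewrite negbK.
pose f : 'Hom('rV[K]_n, 'rV[K]_1) := linfun (mulmxr phi).
have fE x : f x = x *m phi by rewrite lfunE.
have ej (c : K) : ((c *: 'e_j : 'rV[K]_n) *m phi) 0 0 = c * phi j 0.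
  by rewrite -scalemxAl -rowE !mxE.
exists ((s / phi j 0) *: 'e_j), (lker f); split.
  have := limg_ker_dim f fullv; rewrite capfv dimvf /dim /= mul1n.
  suff -> : \dim (limg f) = 1%N by rewrite addn1.
  apply/eqP; rewrite eqn_leq; apply/andP; split.
    by have := dimvS (subvf (limg f)); rewrite dimvf /dim /= mul1n.
  rewrite lt0n dimv_eq0; apply/eqP => limg0.
  have : f ('e_j) \in limg f by rewrite memv_img ?memvf.
  rewrite limg0 memv0 fE => /eqP/rowP/(_ 0); have := ej 1.
  by rewrite scale1r mul1r => ->; rewrite mxE => /eqP; rewrite (negPf phij).
apply/seteqP; split=> [x /= xs|_ [x /= xf <-]].
  exists (x - (s / phi j 0) *: 'e_j); last by rewrite addrC subrK.
  rewrite /= memv_ker fE mulmxBl; apply/eqP/rowP => k; rewrite ord1 mxE [LHS]/=.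
  by rewrite xs [X in _ + X]mxE ej divfK // mxE subrr.
by move: xf; rewrite memv_ker fE mulmxDl mxE ej divfK // => /eqP ->; rewrite mxE addr0.
Qed.

(** A linear form vanishing on the direction [V] is a nonzero coordinate of
    [x - projv V x]. *)
Lemma hyperplane_sub_level (H : set 'rV[K]_n) : hyperplane H ->
  exists phi : 'cV[K]_n, exists2 s, phi != 0 &
    forall x, H x -> (x *m phi) 0 0 = s.
Proof.
move=> [p [V [dV ->]]].
have /subvPn[x _ xV] : ~~ (fullv <= V)%VS.
  by apply/negP => /dimvS; rewrite dimvf /dim /= mul1n -[leqLHS]dV ltnn.
pose g : 'Hom('rV[K]_n, 'rV[K]_n) := (\1 - projv V)%VF.
have gV y : y \in V -> g y = 0.
  by move=> yV; rewrite !lfunE /= !lfunE /= projv_id // subrr.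
have [j gxj] : exists j, g x 0 j != 0.
  apply/existsP; apply: contraNT xV => /existsPn h.
  suff : g x = 0.
    by rewrite !lfunE /= !lfunE /= => /eqP; rewrite subr_eq0 => /eqP ->; exact: memv_proj.
  by apply/rowP => k; rewrite mxE; apply/eqP; move: (h k); rewrite negbK.
pose phi := col j (lin1_mx g).
have phiE y : (y *m phi) 0 0 = g y 0 j.
  by rewrite /phi colE mulmxA -colE mul_rV_lin1 mxE.
exists phi, ((p *m phi) 0 0).
  by apply/eqP => phi0; move: gxj; rewrite -phiE phi0 mulmx0 mxE eqxx.
by move=> _ [y /= yV <-]; rewrite mulmxDl mxE (phiE y) gV // [X in _ + X]mxE addr0.
Qed.

Lemma flat_sub_set1 (c : 'rV[K]_n) (A : set 'rV[K]_n) : (0 < n)%N ->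
  A `<=` [set c] -> flat A.
Proof.
move=> n0 Ac; pose one : 'cV[K]_n := const_mx 1.
exists [set x | (x *m one) 0 0 = (c *m one) 0 0]; last by move=> x /Ac ->.
apply: hyperplane_level; apply/matrix0Pn; exists (Ordinal n0), 0.
by rewrite mxE oner_eq0.
Qed.

Lemma nonflat_nonempty (A : set 'rV[K]_n) :
  (0 < n)%N -> ~ flat A -> A !=set0.
Proof.
move=> n0 nf; apply: contrapT => A0; apply: nf.
apply: (flat_sub_set1 (c := 0)) => // x Ax.
by exfalso; apply: A0; exists x.
Qed.

Lemma lineP (l : set 'rV[K]_n) : line l ->
  exists p, exists2 v, v != 0 & l = [set p + t *: v | t in setT].
Proof.
move=> [p [V [dV ->]]].
have v0 : vpick V != 0 by rewrite vpick0 -dimv_eq0 dV.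
have /eqP VE : <[vpick V]>%VS == V.
  by rewrite eqEdim -memvE memv_pick dV dim_vline v0.
exists p, (vpick V) => //.
apply/seteqP; split=> [y [w /= wV <-]|_ [t _ <-]].
  by have /vlineP[t ->] : w \in <[vpick V]>%VS; [rewrite VE|exists t].
by exists (t *: vpick V) => //=; rewrite memvZ ?memv_pick.
Qed.

Lemma line_through (p v : 'rV[K]_n) : v != 0 -> line [set p + t *: v | t in setT].
Proof.
move=> v0; exists p, <[v]>%VS; rewrite dim_vline v0; split=> //.
apply/seteqP; split=> [_ [t _ <-]|_ [_ /vlineP[t ->] <-]]; last by exists t.
by exists (t *: v) => //=; rewrite memvZ ?memv_line.
Qed.
End Hyperplanes.

(** * Continuity of matrix functions and affine frames *)

Section EntrywiseContinuity.
Variables (R : realType) (T : topologicalType).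

Definition mx_continuous p q (F : T -> 'M[R]_(p, q)) :=
  forall i j, continuous (fun v => F v i j).

Lemma mx_continuous_cst p q (A : 'M[R]_(p, q)) : mx_continuous (fun=> A).
Proof. by move=> i j; exact: cst_continuous. Qed.

Lemma mx_continuous_tr p q (F : T -> 'M[R]_(p, q)) :
  mx_continuous F -> mx_continuous (fun v => (F v)^T).
Proof. by move=> Fc i j; under eq_fun do rewrite mxE; exact: Fc. Qed.

Lemma mx_continuous_mul p q r (F : T -> 'M[R]_(p, q)) (G : T -> 'M[R]_(q, r)) :
  mx_continuous F -> mx_continuous G -> mx_continuous (fun v => F v *m G v).
Proof.
move=> Fc Gc i j; under eq_fun do rewrite mxE.
apply: continuous_big; first exact: add_continuous.
by move=> k _ v; apply: cvgM; [exact: Fc|exact: Gc].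
Qed.

Lemma continuous_det p (F : T -> 'M[R]_p) :
  mx_continuous F -> continuous (fun v => \det (F v)).
Proof.
move=> Fc; apply: continuous_big; first exact: add_continuous.
move=> s _ v; apply: cvgM; first exact: cvg_cst.
apply: cvg_big; first exact: mul_continuous.
by move=> i _; exact: Fc.
Qed.
End EntrywiseContinuity.

Lemma mx_continuous_id (R : realType) p q :
  mx_continuous (fun M : 'M[R]_(p, q) => M).
Proof. by move=> i j; exact: coord_continuous. Qed.

Lemma mx_continuous_vec_mx (R : realType) p q :
  mx_continuous (fun v : 'rV[R]_(p * q) => vec_mx v).
Proof.
move=> i j; under eq_fun do rewrite mxE.
exact: coord_continuous.
Qed.

Definition quad (K : pzRingType) n (Q : 'M[K]_n) (x : 'rV[K]_n) : K :=
  (x *m Q *m x^T) 0 0.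

Definition homog (K : pzRingType) m (x : 'rV[K]_m) : 'rV[K]_(1 + m) :=
  row_mx 1%:M x.

Section AffineFrame.
Variables (K : fieldType) (m : nat).

(** A non-flat set contains an affine frame, found by adding points greedily: as
    long as the points found so far do not span, some linear form [psi] in
    homogeneous coordinates vanishes on them, but not on the whole set. *)
Lemma nonflat_frame (B : set 'rV[K]_m) : (0 < m)%N -> ~ flat B ->
  exists2 T : 'M[K]_(1 + m), T \in unitmx &
    forall i, exists2 x, B x & row i T = homog x.
Proof.
move=> m0 Bnf.
suff H k : (k <= 1 + m)%N -> exists2 T : 'M[K]_(k, 1 + m), row_free T &
    forall i, exists2 x, B x & row i T = homog x.
  have [T Tf TB] := H (1 + m)%N (leqnn _).
  by exists T => //; rewrite -row_free_unit.
elim: k => [_|k IH km].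
  by exists 0 => [|[]//]; rewrite /row_free mxrank0.
have [T Tf TB] := IH (ltnW km).
have [psi psi0 Tpsi] : exists2 psi : 'cV[K]_(1 + m), psi != 0 & T *m psi = 0.
  have : cokermx T != 0.
    rewrite -mxrank_eq0 mxrank_coker subn_eq0 -ltnNge.
    by move: Tf => /eqP ->.
  case/matrix0Pn => i [j cij]; exists (col j (cokermx T)).
    by apply/matrix0Pn; exists i, 0; rewrite mxE.
  by rewrite colE mulmxA mulmx_coker mul0mx.
(* Otherwise [psi] is an affine equation of a hyperplane containing [B], unless
   it is a constant, which is possible only for empty [B]. *)
have [x Bx xpsi] : exists2 x, B x & homog x *m psi != 0.
  apply: contrapT => h; apply: Bnf.
  have {}h x : B x -> homog x *m psi = 0.
    move=> Bx; apply: contrapT => /eqP hx; apply: h; exists x => //.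
  have hx x : homog x *m psi = usubmx psi + x *m dsubmx psi.
    by rewrite -{1}(vsubmxK psi) mul_row_col mul1mx.
  have [d0|d0] := eqVneq (dsubmx psi) 0.
    have B0 x : ~ B x.
      move=> /h; rewrite hx d0 mulmx0 addr0 => u0.
      by case/eqP: psi0; rewrite -(vsubmxK psi) u0 d0 col_mx0.
    exists [set x : 'rV[K]_m | (x *m (const_mx 1 : 'cV_m)) 0 0 = 0]; last by move=> x /B0.
    apply: hyperplane_level; apply/matrix0Pn; exists (Ordinal m0), 0.
    by rewrite mxE oner_eq0.
  exists [set x | (x *m dsubmx psi) 0 0 = - usubmx psi 0 0].
    exact: hyperplane_level.
  move=> x /h /=; rewrite hx => /matrixP/(_ 0 0); rewrite !mxE => /eqP.
  by rewrite addrC addr_eq0 => /eqP.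
have free : row_free (col_mx (homog x) T).
  rewrite -kermx_eq0; apply/eqP/row_matrixP => i; rewrite row0.
  have := row_sub i (kermx (col_mx (homog x) T)).
  move/sub_kermxP; move: (row i _) => w.
  rewrite -[w]hsubmxK mul_row_col => w0.
  have l0 : lsubmx w = 0.
    have := congr1 (mulmx^~ psi) w0.
    rewrite mulmxDl -!mulmxA Tpsi mulmx0 addr0 mul0mx.
    rewrite [lsubmx w]mx11_scalar mul_scalar_mx => /eqP.
    by rewrite scalemx_eq0 (negPf xpsi) orbF => /eqP ->; rewrite raddf0.
  move: w0; rewrite l0 mul0mx add0r => /eqP; rewrite mulmx_free_eq0 // => /eqP ->.
  by rewrite row_mx0.
exists (col_mx (homog x) T) => // i; case: (@split_ordP 1 k i) => j ->.
  exists x => //; apply: etrans (rowKu j (homog x) T) _.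
  by apply/rowP => l; rewrite mxE ord1.
by have [y By Ty] := TB j; exists y => //; rewrite -Ty; exact: rowKd.
Qed.
End AffineFrame.

(** * Quadratic forms admissible for a set *)

Section Quad.
Variables (R : comNzRingType) (n : nat).
Implicit Types (Q : 'M[R]_n) (x y : 'rV[R]_n).

Lemma quad_congr p (A : 'M[R]_(p, n)) Q (x : 'rV[R]_p) :
  quad (A *m Q *m A^T) x = quad Q (x *m A).
Proof. by rewrite /quad trmx_mul !mulmxA. Qed.

Lemma quad_line Q x y t : Q^T = Q ->
  quad Q (x + t *: y) = quad Q x + 2 * t * (x *m Q *m y^T) 0 0 + t ^+ 2 * quad Q y.
Proof.
move=> QT; rewrite /quad linearD linearZ /= !(mulmxDl, mulmxDr).
rewrite -!(scalemxAl, scalemxAr).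
rewrite (sym_formC y x QT).
by rewrite !mxE; ring.
Qed.

Lemma quadD Q Q' x : quad (Q + Q') x = quad Q x + quad Q' x.
Proof. by rewrite /quad mulmxDr mulmxDl mxE. Qed.

Lemma quadZ a Q x : quad (a *: Q) x = a * quad Q x.
Proof. by rewrite /quad -scalemxAr -scalemxAl mxE. Qed.
End Quad.

Section PositiveSemidefinite.
Variables (R : realFieldType) (n : nat) (Q : 'M[R]_n).
Hypotheses (QT : Q^T = Q) (Qge0 : forall x, 0 <= quad Q x).

(** A form of the Cauchy-Schwarz inequality. Applied to the vectors of a frame it
    bounds all the entries of a form by its diagonal, which will give the
    compactness of a set of forms. *)
Lemma psd_cross_le1 (x y : 'rV[R]_n) : quad Q x <= 1 -> quad Q y <= 1 ->
  -1 <= (x *m Q *m y^T) 0 0 <= 1.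
Proof.
move=> x1 y1; have := Qge0 (x + 1 *: y); have := Qge0 (x + (-1) *: y).
by rewrite !quad_line // => h1 h2; apply/andP; split; lra.
Qed.

(** An isotropic vector of a semidefinite form lies in its kernel: otherwise the
    form would take negative values on a line in the direction of this
    vector. *)
Lemma psd_unit_pos (x : 'rV[R]_n) : Q \in unitmx -> x != 0 -> 0 < quad Q x.
Proof.
move=> Qu x0; rewrite lt_neqAle Qge0 andbT eq_sym; apply: contra_neq x0 => qx.
have xQ (y : 'rV[R]_n) : (y *m Q *m x^T) 0 0 = 0.
  apply/eqP; apply: contraT => c0; set c := (_ *m x^T) 0 0 in c0.
  (* The multiple of [x] is chosen so that the form takes the value -1. *)
  have := Qge0 (y + (- (quad Q y + 1) / (2 * c)) *: x).
  rewrite quad_line // qx mulr0 addr0 -/c.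
  have -> : quad Q y + 2 * (- (quad Q y + 1) / (2 * c)) * c = - 1 by field.
  by rewrite ler0N1.
have Qx : Q *m x^T = 0.
  apply/colP => i; by rewrite [RHS]mxE -(xQ 'e_i) -mulmxA -rowE [RHS]mxE.
by rewrite -[x]trmxK -(mulKmx Qu x^T) Qx mulmx0 trmx0.
Qed.
End PositiveSemidefinite.

Section Loewner.
Variables (R : realType) (m : nat).

(** The form [Q] is in homogeneous coordinates: the set where it is at most 1 on
    the affine hyperplane of the points [homog x] is a possibly degenerate
    ellipsoid that contains [B] and whose center is not prescribed. *)
Definition admissible (B : set 'rV[R]_m) (Q : 'M[R]_(1 + m)) :=
  [/\ Q^T = Q, forall y, 0 <= quad Q y & forall x, B x -> quad Q (homog x) <= 1].

Lemma mx_continuous_quad (T : topologicalType) n (F : T -> 'M[R]_n) x :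
  mx_continuous F -> continuous (fun v => quad (F v) x).
Proof.
move=> Fc; apply: mx_continuous_mul; last exact: mx_continuous_cst.
by apply: mx_continuous_mul => //; exact: mx_continuous_cst.
Qed.

Lemma closed_admissible (B : set 'rV[R]_m) (T : topologicalType)
    (F : T -> 'M[R]_(1 + m)) :
  mx_continuous F -> closed [set v | admissible B (F v)].
Proof.
move=> Fc.
have -> : [set v | admissible B (F v)] =
    (\bigcap_(ij in setT) [set v | F v ij.1 ij.2 - F v ij.2 ij.1 = 0]) `&`
    ((\bigcap_(y in setT) [set v | 0 <= quad (F v) y]) `&`
     (\bigcap_(x in B) [set v | quad (F v) (homog x) <= 1])).
  apply/seteqP; split=> [v [FT F0 F1]|v [FT [F0 F1]]].
    by split=> [[i j] _ /=|]; [rewrite -{1}FT mxE subrr|split=> [y _|x Bx] /=; auto].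
  split=> [|y|x Bx]; [|exact: F0|exact: F1].
  apply/matrixP => i j; rewrite mxE; apply/eqP; rewrite -subr_eq0.
  by apply/eqP/(FT (j, i)).
apply: closedI.
  apply: closed_bigI => ij _.
  apply: (@preimage_closed _ _ (fun v => F v ij.1 ij.2 - F v ij.2 ij.1)
    _ _ (@closed_eq _ 0)).
  by move=> v _; apply: cvgB; exact: Fc.
apply: closedI; apply: closed_bigI => x _.
  apply: (@preimage_closed _ _ (fun v => quad (F v) x) _ _ (@closed_ge _ 0)).
  by move=> v _; exact: mx_continuous_quad.
apply: (@preimage_closed _ _ (fun v => quad (F v) (homog x)) _ _ (@closed_le _ 1)).
by move=> v _; exact: mx_continuous_quad.
Qed.
End Loewner.

(** * The Loewner ellipsoid and its symmetries *)

Section LoewnerMaximum.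
Variables (R : realType) (m : nat) (B : set 'rV[R]_m).
Hypotheses (m_gt0 : (0 < m)%N) (cB : compact B) (nfB : ~ flat B).

Lemma homog_normE (x : 'rV[R]_m) : quad 1%:M (homog x) = 1 + (x *m x^T) 0 0.
Proof. by rewrite /quad mulmx1 tr_row_mx mul_row_col trmx1 mulmx1 !mxE eqxx. Qed.

Lemma row_dot_ge0 (n : nat) (x : 'rV[R]_n) : 0 <= (x *m x^T) 0 0.
Proof. by rewrite mxE sumr_ge0 // => i _; rewrite mxE -expr2 sqr_ge0. Qed.

Lemma admissible_scalar : B !=set0 ->
  exists2 e : R, 0 < e & admissible B (e *: 1%:M).
Proof.
move=> B0.
have : {within B, continuous (fun x : 'rV[R]_m => (x *m x^T) 0 0)}.
  apply: continuous_subspaceT; apply: mx_continuous_mul.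
    exact: mx_continuous_id.
  by apply: mx_continuous_tr; exact: mx_continuous_id.
case/(compact_EVT_max B0 cB) => c _ cmax.
set r := (c *m c^T) 0 0 in cmax.
have r0 : 0 <= r by exact: row_dot_ge0.
exists (1 + r)^-1; first by rewrite invr_gt0; lra.
split=> [|y|x Bx].
- by rewrite linearZ /= trmx1.
- by rewrite quadZ mulr_ge0 ?invr_ge0 ?addr_ge0 // /quad mulmx1 row_dot_ge0.
- rewrite quadZ homog_normE mulrC ler_pdivrMr; last by lra.
  by rewrite mul1r lerD2l cmax // inE.
Qed.

(** The entries of an admissible form in an affine frame of points of [B] lie
    between -1 and 1, so the admissible forms are parametrized by a closed
    subset of a cube, on which the determinant attains its maximum. The maximum
    is positive since small multiples of the standard form are admissible. *)
Lemma loewner_exists : exists2 Q, admissible B Q /\ 0 < \det Q &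
  forall Q', admissible B Q' -> \det Q' <= \det Q.
Proof.
have [T Tu TB] := nonflat_frame m_gt0 nfB.
have B0 : B !=set0 by have [x Bx _] := TB 0; exists x.
have [e e0 eadm] := admissible_scalar B0.
pose W := invmx T.
(* [v] lists the entries of the form in the frame [T]. *)
pose F (v : 'rV[R]_((1 + m) * (1 + m))) := W *m vec_mx v *m W^T.
have FT Q : F (mxvec (T *m Q *m T^T)) = Q.
  rewrite /F mxvecK !mulmxA mulVmx // mul1mx -mulmxA -trmx_mul mulVmx //.
  by rewrite trmx1 mulmx1.
have Fc : mx_continuous F.
  apply: mx_continuous_mul; last exact: mx_continuous_cst.
  by apply: mx_continuous_mul; [exact: mx_continuous_cst|exact: mx_continuous_vec_mx].
pose S := [set v | admissible B (F v)].
have clS : closed S by exact: closed_admissible.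
have cube : compact [set v : 'rV[R]_((1 + m) * (1 + m)) |
    forall k, v ord0 k \in `[(-1 : R), 1]].
  apply: (@rV_compact _ _ (fun=> `[(-1 : R), 1]%classic)) => _.
  exact: segment_compact.
have cS : compact S.
  apply: subclosed_compact clS cube _.
  move=> v [QT Q0 Q1] k /=; case/mxvec_indexP: k => i j.
  have -> : v ord0 (mxvec_index i j) = vec_mx v i j by rewrite mxE.
  have -> : vec_mx v = T *m F v *m T^T.
    rewrite /F !mulmxA mulmxV // mul1mx -mulmxA -trmx_mul mulmxV //.
    by rewrite trmx1 mulmx1.
  have -> : (T *m F v *m T^T) i j = (row i T *m F v *m (row j T)^T) 0 0.
    by rewrite tr_row -!row_mul colE mulmxA -colE !mxE.
  have [x Bx ->] := TB i; have [y By ->] := TB j.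
  by rewrite in_itv /=; apply: psd_cross_le1 => //; exact: Q1.
have S0 : S !=set0 by exists (mxvec (T *m (e *: 1%:M) *m T^T)); rewrite /S /= FT.
have : {within S, continuous (fun v => \det (F v))}.
  by apply: continuous_subspaceT; exact: continuous_det.
case/(compact_EVT_max S0 cS) => v; rewrite inE => Sv vmax.
have Qmax Q' : admissible B Q' -> \det Q' <= \det (F v).
  by move=> Q'adm; rewrite -[in leLHS](FT Q') vmax // inE /S /= FT.
exists (F v) => //; split=> //.
apply: lt_le_trans (Qmax _ eadm).
by rewrite detZ det1 mulr1 exprn_gt0.
Qed.

(** The action of [x |-> x *m L + b] on homogeneous coordinates, see
    [homog_affine]. *)
Definition affine_mx (L : 'M[R]_m) (b : 'rV[R]_m) : 'M[R]_(1 + m) :=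
  block_mx 1%:M b 0 L.

Lemma homog_affine L b x : homog x *m affine_mx L b = homog (x *m L + b).
Proof. by rewrite /homog mul_row_block !mul1mx mulmx0 addr0 addrC. Qed.

Lemma det_affine_mx L b : \det (affine_mx L b) = \det L.
Proof. by rewrite det_ublock det1 mul1r. Qed.

Lemma admissible_affine L b Q : (forall x, B x -> B (x *m L + b)) ->
  admissible B Q -> admissible B (affine_mx L b *m Q *m (affine_mx L b)^T).
Proof.
move=> LB [QT Q0 Q1]; split=> [|y|x Bx].
- by rewrite !trmx_mul trmxK QT mulmxA.
- by rewrite quad_congr.
- by rewrite quad_congr homog_affine; apply/Q1/LB.
Qed.

Lemma admissible_midpoint Q Q' : admissible B Q -> admissible B Q' ->
  admissible B (2^-1 *: (Q + Q')).
Proof.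
move=> [QT Q0 Q1] [Q'T Q'0 Q'1]; split=> [|y|x Bx].
- by rewrite linearZ linearD /= QT Q'T.
- by rewrite quadZ quadD; have := Q0 y; have := Q'0 y; lra.
- by rewrite quadZ quadD; have := Q1 x Bx; have := Q'1 x Bx; lra.
Qed.

Lemma admissible_posdef Q : admissible B Q -> 0 < \det Q -> symmetric_posdef Q.
Proof.
move=> [QT Q0 _] dQ; split=> // x x0; apply: psd_unit_pos => //.
by rewrite unitmxE unitfE gt_eqF.
Qed.

(** The transform of [Q] by an automorphism is admissible, so its determinant is
    at most that of [Q]; the same for the inverse forces equality. The midpoint
    of [Q] and its transform is then admissible too, and strict concavity shows
    that they coincide. Of the inverse map only the linear part matters, so its
    translation [b'] is left free. *)
Lemma loewner_invariant Q L b L' b' : admissible B Q -> 0 < \det Q ->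
  (forall Q', admissible B Q' -> \det Q' <= \det Q) ->
  L *m L' = 1%:M -> (forall x, B x -> B (x *m L + b)) ->
  (forall x, B x -> B (x *m L' + b')) ->
  affine_mx L b *m Q *m (affine_mx L b)^T = Q.
Proof.
move=> Qadm dQ Qmax LL' LB L'B.
have Lad := admissible_affine LB Qadm.
have L'ad := admissible_affine L'B Qadm.
have dle M c : admissible B (affine_mx M c *m Q *m (affine_mx M c)^T) ->
    (\det M) ^+ 2 <= 1.
  move=> /Qmax; rewrite !det_mulmx det_tr det_affine_mx mulrAC -expr2.
  by rewrite ger_pMl.
have dLL' : \det L * \det L' = 1 by rewrite -det_mulmx LL' det1.
have dL2 : (\det L) ^+ 2 = 1.
  apply/eqP; rewrite eq_le (dle _ _ Lad) /=.
  have := dle _ _ L'ad; have : (\det L * \det L') ^+ 2 = 1 by rewrite dLL' expr1n.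
  rewrite exprMn; have := sqr_ge0 (\det L); nra.
have dE : \det (affine_mx L b *m Q *m (affine_mx L b)^T) = \det Q.
  by rewrite !det_mulmx det_tr det_affine_mx mulrAC -expr2 dL2 mul1r.
apply: symmetric_det_midpoint_eq => //.
- by apply: admissible_posdef; rewrite ?dE.
- exact: admissible_posdef.
have := Qmax _ (admissible_midpoint Lad Qadm).
rewrite detZ dE exprVn mulrC ler_pdivrMr ?exprn_gt0 //.
by rewrite mulrC.
Qed.

(** The invariant form on homogeneous coordinates is a constant plus
    [quad M (x - c)], where [c] is its minimum on the affine hyperplane of the
    points [homog x]. An affine automorphism preserves this hyperplane and the
    form, hence fixes [c]. *)
Lemma invariant_ellipsoid : exists (c : 'rV[R]_m) (M : 'M[R]_m),
  symmetric_posdef M /\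
  forall L b L' b', L *m L' = 1%:M -> (forall x, B x -> B (x *m L + b)) ->
    (forall x, B x -> B (x *m L' + b')) ->
    c *m L + b = c /\ L *m M *m L^T = M.
Proof.
have [Q [Qadm dQ] Qmax] := loewner_exists.
have [QT Qpos] := admissible_posdef Qadm dQ.
pose M := drsubmx Q; pose beta := ursubmx Q; pose alpha := ulsubmx Q.
have MT : M^T = M by rewrite /M trmx_drsub QT.
have betaT : beta^T = dlsubmx Q by rewrite /beta trmx_ursub QT.
have QE : Q = block_mx alpha beta beta^T M by rewrite betaT submxK.
have Mpos : symmetric_posdef M.
  split=> // x x0; have : row_mx (0 : 'M[R]_1) x != 0.
    apply: contra_neq x0 => /(congr1 rsubmx); by rewrite row_mxKr raddf0.
  move/Qpos; rewrite QE mul_row_block tr_row_mx mul_row_col !mul0mx !add0r.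
  by rewrite trmx0 mulmx0 add0r.
have Mu : M \in unitmx.
  rewrite -row_free_unit -kermx_eq0; apply/eqP/row_matrixP => i; rewrite row0.
  apply/eqP; apply: contraT => /(proj2 Mpos).
  have /sub_kermxP -> := row_sub i (kermx M).
  by rewrite mul0mx mxE ltxx.
pose c := (- beta) *m invmx M.
have betaE : beta = (- c) *m M by rewrite /c !mulNmx opprK mulmxKV.
exists c, M; split=> // L b L' b' LL' LB L'B.
have := loewner_invariant Qadm dQ Qmax LL' LB L'B.
rewrite {1}QE /affine_mx tr_block_mx !mulmx_block.
rewrite !trmx1 trmx0 !mulmx0 !mul0mx !mulmx1 !mul1mx !add0r ?addr0.
rewrite [RHS]QE => /eq_block_mx[_ _ dl dr].
split=> //.
have LMu : L *m M \in unitmx by rewrite unitmx_mul Mu andbT; have [] := mulmx1_unit LL'.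
move: dl; rewrite betaE trmx_mul MT.
rewrite linearN /= !mulmxN mulmxA => dl'.
apply: trmx_inj; apply: (can_inj (mulKmx LMu)).
rewrite linearD /= trmx_mul mulmxDr [L *m M *m (_ *m _)]mulmxA dr.
by apply/eqP; rewrite -[M *m _]opprK -dl' opprD opprK addrNK.
Qed.
End LoewnerMaximum.

(** * Sections of a set by lines *)

Section Sections.
Variables (K : numFieldType) (n : nat) (A : set 'rV[K]_n).

Lemma unit_invariantZ (Y : set 'rV[K]_n) (z : K) y :
  unit_invariant Y -> `|z| = 1 -> Y y -> Y (z *: y).
Proof. by move=> YI z1 Yy; rewrite -(YI z z1); exists y. Qed.

Lemma symmetric_atP (c x : 'rV[K]_n) X (z : K) : symmetric_at c X ->
  X x -> `|z| = 1 -> X (c + z *: (x - c)).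
Proof.
move=> [Y YI ->] [y Yy <-] z1; exists (z *: (c + y - c)) => //.
by rewrite addrC addKr; exact: unit_invariantZ.
Qed.

(** [symmetric_at] does not ask the center to lie on the line; it does, being
    the midpoint of [x] and its image under the central symmetry. *)
Lemma center_on_line (c x p v : 'rV[K]_n) X :
  X `<=` [set p + t *: v | t in setT] -> symmetric_at c X -> X x ->
  exists t, x - c = t *: v.
Proof.
move=> Xl Xc Xx.
have [t _ xE] := Xl _ Xx.
have N1 : `|-1 : K| = 1 by rewrite normrN1.
have [t' _ x'E] := Xl _ (symmetric_atP Xc Xx N1).
exists ((t - t') / 2); apply/(scalerI (a := 2)); rewrite ?pnatr_eq0 //.
rewrite scalerA mulrC divfK ?pnatr_eq0 // scalerBl.
have -> : t *: v = x - p by rewrite -xE addrC addKr.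
have -> : t' *: v = c + -1 *: (x - c) - p by rewrite -x'E addrC addKr.
rewrite scaleN1r scaler_nat mulr2n; apply/rowP => i; rewrite !mxE; ring.
Qed.

(** The fixed hyperplane is the level [s] of [phi]. The normalization
    [v *m phi = 1] is possible because the hyperplane of the centers is not
    parallel to [v]: the center of the section through [a] differs from [a] by a
    multiple of [v], so a form [phi] vanishing at [v] would be constant
    on [A]. *)
Lemma section_reflection : round_sections A -> hyperplanar_centers A ->
  ~ flat A -> forall v, v != 0 ->
  exists (phi : 'cV[K]_n) (s : K), (v *m phi) 0 0 = 1 /\
    forall z a, `|z| = 1 -> A a -> A (a + ((z - 1) * ((a *m phi) 0 0 - s)) *: v).
Proof.
move=> Ar Ah nf v v0.
have [H /hyperplane_sub_level[phi [s phi0 Hs]] cH] := Ah _ (line_through 0 v0).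
have center a : A a -> exists c t, [/\ a - c = t *: v, (c *m phi) 0 0 = s
    & forall z, `|z| = 1 -> A (c + (z * t) *: v)].
  move=> Aa; pose l := [set a + t *: v | t in setT].
  have la : l a by exists 0 => //; rewrite scale0r addr0.
  have Al : A `&` l !=set0 by exists a.
  have [_ [c cl]] := Ar _ (line_through a v0) Al.
  have [t tE] := center_on_line (@subIsetr _ _ _) cl (conj Aa la).
  exists c, t; split=> // [|z z1].
    apply/Hs/cH; exists l; split=> //; exists a.
    apply/seteqP; split=> [x [u _ <-]|x [_ [u _ <-] <-]]; last first.
      by exists u => //; rewrite add0r.
    by exists (u *: v) => //; exists u => //; rewrite add0r.
  have [] := symmetric_atP cl (conj Aa la) z1.
  by rewrite tE scalerA.
have vphi0 : (v *m phi) 0 0 != 0.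
  apply/eqP => vphi; apply: nf.
  exists [set x | (x *m phi) 0 0 = s]; first exact: hyperplane_level.
  move=> a /center[c [t [acE cs _]]] /=.
  by rewrite -(subrK c a) acE mulmxDl -scalemxAl 2!mxE vphi mulr0 add0r.
set k := (v *m phi) 0 0 in vphi0.
exists (k^-1 *: phi), (k^-1 * s); split.
  by rewrite -scalemxAr mxE mulVf.
move=> z a z1 Aa; have [c [t [acE cs]]] := center a Aa.
move/(_ z z1); congr A.
have -> : (a *m (k^-1 *: phi)) 0 0 - k^-1 * s = t.
  rewrite -scalemxAr mxE -mulrBr -cs.
  have -> : (a *m phi) 0 0 - (c *m phi) 0 0 = ((a - c) *m phi) 0 0.
    by rewrite mulmxBl [RHS]mxE; congr (_ + _); rewrite [RHS]mxE.
  by rewrite acE -scalemxAl mxE -/k mulrCA mulVf // mulr1.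
rewrite mulrBl mul1r scalerBl -acE opprB addrA.
by rewrite [RHS]addrC addrA subrK.
Qed.

Lemma round_sections_convex x y t : round_sections A -> A x -> A y ->
  0 <= t -> t <= 1 -> A (t *: x + (1 - t) *: y).
Proof.
move=> Ar Ax Ay t0 t1; have [<-|xy] := eqVneq x y.
  by rewrite -scalerDl subrKC scale1r.
have v0 : y - x != 0 by rewrite subr_eq0 eq_sym.
have lx : [set x + u *: (y - x) | u in setT] x by exists 0; rewrite ?scale0r ?addr0.
have ly : [set x + u *: (y - x) | u in setT] y by exists 1; rewrite ?scale1r ?subrKC.
have [|/(_ x y (Itv01 t0 t1)) cA _] := Ar _ (line_through x v0); first by exists x.
by have := cA (mem_set (conj Ax lx)) (mem_set (conj Ay ly)); rewrite inE => -[].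
Qed.
End Sections.

(** * Ellipsoids, reflections and centers of sections *)

Section Ellipsoids.
Variables (K : numFieldType) (theta : {rmorphism K -> K}) (n : nat).
Hypothesis thetaE : forall t : K, t * theta t = `|t| ^+ 2.
Hypothesis sqrtE : forall a : K, 0 <= a -> exists2 t : K, 0 <= t & t ^+ 2 = a.
Implicit Types (M : 'M[K]_n) (A : set 'rV[K]_n).

Lemma formDl M x y z : form theta M (x + y) z = form theta M x z + form theta M y z.
Proof. by rewrite /form !mulmxDl mxE. Qed.

Lemma formDr M x y z : form theta M x (y + z) = form theta M x y + form theta M x z.
Proof. by rewrite /form linearD /= map_mxD mulmxDr mxE. Qed.

Lemma formZl M t x y : form theta M (t *: x) y = t * form theta M x y.
Proof. by rewrite /form -!scalemxAl mxE. Qed.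

Lemma formZr M t x y : form theta M x (t *: y) = theta t * form theta M x y.
Proof. by rewrite /form linearZ /= map_mxZ -scalemxAr mxE. Qed.

Lemma theta_norm (t : K) : 0 <= t -> theta t = t.
Proof.
move=> t0; have [->|tn0] := eqVneq t 0; first by rewrite rmorph0.
by apply: (mulfI tn0); rewrite thetaE ger0_norm.
Qed.

(** Since [theta] fixes [t * theta t], which is nonnegative. *)
Lemma theta_invol : involutive theta.
Proof.
move=> t; have [->|t0] := eqVneq t 0; first by rewrite !rmorph0.
have tt0 : theta t != 0 by rewrite fmorph_eq0.
apply: (mulfI tt0); rewrite -rmorphM thetaE [LHS]theta_norm ?exprn_ge0 //.
by rewrite [RHS]mulrC thetaE.
Qed.

Lemma form_sqZ M t x : form theta M (t *: x) (t *: x) = `|t| ^+ 2 * form theta M x x.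
Proof. by rewrite formZl formZr mulrA thetaE. Qed.

Lemma form_parallelogram M x y :
  form theta M (x + y) (x + y) + form theta M (x - y) (x - y) =
  2 * (form theta M x x + form theta M y y).
Proof. by rewrite -scaleN1r !(formDl, formDr, formZl, formZr) rmorphN1; ring. Qed.

(** By the parallelogram law: a reflection that fixes [x], maps [y] to [- y] and
    is an isometry makes [x] and [y] orthogonal. *)
Lemma pythagoras_of_reflection M x y :
  form theta M (x + y) (x + y) = form theta M (x - y) (x - y) ->
  form theta M (x + y) (x + y) = form theta M x x + form theta M y y.
Proof.
move=> h; have two0 : 2 != 0 :> K by rewrite pnatr_eq0.
apply: (mulfI two0); rewrite -form_parallelogram -h.
by rewrite mulrDl mul1r.
Qed.

Lemma pythagoras M x y : form theta M x y = 0 -> form theta M y x = 0 ->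
  form theta M (x + y) (x + y) = form theta M x x + form theta M y y.
Proof. by move=> xy yx; rewrite formDl !formDr xy yx addr0 add0r. Qed.

Lemma form_conj M x y : M \is hermitianmx n false theta ->
  form theta M x y = 0 -> form theta M y x = 0.
Proof.
move=> /is_hermitianmxP; rewrite expr0 scale1r => Mh xy0.
have MT : map_mx theta M = M^T.
  by rewrite [in RHS]Mh; apply/matrixP => i j; rewrite !mxE.
suff -> : form theta M y x = theta (form theta M x y) by rewrite xy0 rmorph0.
have e11 (X : 'M[K]_1) : X 0 0 = X^T 0 0 by rewrite mxE.
have mapE (X : 'M[K]_1) : theta (X 0 0) = (map_mx theta X) 0 0 by rewrite mxE.
rewrite /form mapE !map_mxM MT [RHS]e11 !trmx_mul trmxK.
rewrite -!map_trmx !trmxK -map_mx_comp (map_mx_id (f := theta \o theta)) ?mulmxA //.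
exact: theta_invol.
Qed.

(** The reflections are isometries fixing [c] and they act transitively on each
    sphere of center [c]. Writing [u = k + t *: v] and
    [w = k + (t - 1) *: v] with [v = u - w] and [k] in the mirror, equality of
    the norms of [u] and [w] means that [t] and [t - 1] have the same modulus, so
    that the reflection with [z = (t - 1) / t] maps [u] to [w]. Thus [A]
    contains the sphere through its farthest point [a], and the ball that it
    bounds by convexity. *)
Lemma ellipsoid_of_reflections M c a A :
  M \is hermitianmx n false theta ->
  (forall x, x != 0 -> 0 < form theta M x x) ->
  (forall v, v != 0 -> exists (phi : 'cV[K]_n) (s : K),
    [/\ (v *m phi) 0 0 = 1, (c *m phi) 0 0 = s &
      forall z, `|z| = 1 ->
        (forall x, A x -> A (x + ((z - 1) * ((x *m phi) 0 0 - s)) *: v)) /\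
        (forall x, let y := x + ((z - 1) * (x *m phi) 0 0) *: v in
           form theta M y y = form theta M x x)]) ->
  (forall x y t, A x -> A y -> 0 <= t -> t <= 1 -> A (t *: x + (1 - t) *: y)) ->
  A a -> a != c ->
  (forall x, A x -> form theta M (x - c) (x - c) <= form theta M (a - c) (a - c)) ->
  ellipsoid theta A.
Proof.
move=> Mh Mpos refl cvx Aa ac amax.
set u := a - c in amax; have u0 : u != 0 by rewrite subr_eq0.
set r := form theta M u u in amax; have r0 : 0 < r := Mpos _ u0.
have sphere w : form theta M w w = r -> A (c + w).
  move=> qw; have [<-|uw] := eqVneq u w; first by rewrite /u subrKC.
  have v0 : u - w != 0 by rewrite subr_eq0.
  have [phi [s [vphi cs zA]]] := refl _ v0.
  move: (u - w) v0 vphi zA (subrKC w u) => v v0 vphi zA uE.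
  set t := (u *m phi) 0 0.
  have qv := Mpos _ v0.
  pose k := u - t *: v.
  have kphi : (k *m phi) 0 0 = 0.
    rewrite /k mulmxBl -scalemxAl [LHS]mxE [X in _ + X]mxE [X in _ - X]mxE vphi.
    by rewrite mulr1 subrr.
  have qk y : form theta M (k + y *: v) (k + y *: v) =
      form theta M k k + `|y| ^+ 2 * form theta M v v.
    rewrite -form_sqZ; apply: pythagoras_of_reflection.
    have N1 : `|-1 : K| = 1 by rewrite normrN1.
    have [_ /(_ (k + y *: v)) /= <-] := zA _ N1.
    have -> : ((k + y *: v) *m phi) 0 0 = y.
      by rewrite mulmxDl -scalemxAl [LHS]mxE kphi [X in _ + X]mxE vphi add0r mulr1.
    suff -> : k + y *: v + ((-1 - 1) * y) *: v = k - y *: v by [].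
    by rewrite -addrA -scalerDl; congr (_ + _); rewrite -scaleNr; congr (_ *: _); ring.
  have uk : u = k + t *: v by rewrite /k subrK.
  have wk : w = k + (t - 1) *: v by rewrite scalerBl scale1r addrA -uk -uE addrK.
  have /(mulIf (lt0r_neq0 qv)) tt : `|t| ^+ 2 * form theta M v v =
      `|t - 1| ^+ 2 * form theta M v v.
    by apply: (addrI (form theta M k k)); rewrite -!qk -uk -wk qw.
  have {}tt : `|t| = `|t - 1|.
    by apply/eqP; rewrite -(eqrXn2 (n := 2)) ?tt.
  have t0 : t != 0.
    apply/eqP => t0; move: tt; rewrite t0 sub0r normrN normr0 normr1 => /eqP.
    by rewrite eq_sym oner_eq0.
  have z1 : `|(t - 1) / t| = 1 by rewrite normrM normfV -tt mulfV ?normr_eq0.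
  have [/(_ _ Aa) + _] := zA _ z1; congr A.
  have -> : (a *m phi) 0 0 - s = t.
    by rewrite -cs /t /u mulmxBl [RHS]mxE; congr (_ + _); rewrite [RHS]mxE.
  have -> : ((t - 1) / t - 1) * t = -1 by field.
  have -> : a = c + (w + v) by rewrite uE /u subrKC.
  by rewrite scaleN1r addrA addrK.
have form_scale x : form theta (r^-1 *: M) x x = r^-1 * form theta M x x.
  by rewrite /form -scalemxAr -scalemxAl mxE.
exists (r^-1 *: M), c; split.
- apply/is_hermitianmxP; move/is_hermitianmxP: Mh; rewrite expr0 !scale1r => MT.
  rewrite {1}MT linearZ /= map_mxZ theta_norm // invr_ge0 ltW //.
- by move=> x x0; rewrite form_scale mulr_gt0 ?invr_gt0 ?Mpos.
have ball w t : form theta M w w = r -> 0 <= t -> t <= 1 -> A (c + t *: w).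
  move=> qw t0 t1.
  (* [t *: w] is the barycenter of [w] and [- w] with weights [(1 + t) / 2] and
     [(1 - t) / 2]. *)
  have half0 : 0 <= (1 + t) / 2 by rewrite divr_ge0 // addr_ge0.
  have half1 : (1 + t) / 2 <= 1 by rewrite ler_pdivrMr // mul1r -[leRHS]/(1 + 1) lerD2l.
  have Aw := sphere w qw.
  have qNw : form theta M (-1 *: w) (-1 *: w) = r.
    by rewrite form_sqZ normrN1 expr1n mul1r.
  have := cvx _ _ _ Aw (sphere _ qNw) half0 half1; congr A.
  apply/rowP => i; rewrite !mxE; by field.
apply/seteqP; split=> [x Ax|_ [x /= + <-]].
  exists (x - c); last exact: subrKC.
  by rewrite /= form_scale mulrC ler_pdivrMr // mul1r amax.
rewrite form_scale mulrC; set t2 := _ / r => t21.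
have [->|x0] := eqVneq x 0; first by rewrite -(scale0r u); exact: ball.
have t20 : 0 < t2 by rewrite divr_gt0 ?Mpos.
have [t t0 tE] := sqrtE (ltW t20).
have tn0 : t != 0 by rewrite -sqrf_eq0 tE gt_eqF.
have t1 : t <= 1 by rewrite -(@expr_le1 _ 2) // tE.
rewrite -(scale1r x) -(mulfV tn0) -scalerA; apply: ball => //.
rewrite form_sqZ normfV ger0_norm // exprVn tE /t2 invf_div mulrC.
by rewrite mulrCA divff ?mulr1 // gt_eqF ?Mpos.
Qed.

(** On the line the ellipsoid is a disk around the projection of [c]; a center
    [d] at distance [`|alpha|] from the projection would reflect the boundary
    point opposite to [d] out of this disk. *)
Lemma hyperplanar_centers_of_ellipsoid A : ellipsoid theta A -> hyperplanar_centers A.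
Proof.
move=> [M [c [Mh Mpos AE]]] _ /lineP[p [v v0 ->]].
pose phi := M *m map_mx theta v^T.
have phiE x : (x *m phi) 0 0 = form theta M x v by rewrite /form /phi mulmxA.
have qv := Mpos _ v0.
exists [set x | (x *m phi) 0 0 = form theta M c v].
  apply: hyperplane_level; apply/eqP => phi0; move: qv.
  by rewrite -phiE phi0 mulmx0 mxE ltxx.
move=> d [_ [[u ->] [x [Ax mx]] dsym]]; rewrite /= phiE.
set l := translate u _ in mx dsym.
have lE : l = [set (u + p) + t *: v | t in setT].
  apply/seteqP; split=> [y [_ [t _ <-] <-]|y [t _ <-]]; first by exists t; rewrite ?addrA.
  by exists (p + t *: v); [exists t|rewrite addrA].
have [|tau tauE] := center_on_line (v := v) (p := u + p) _ dsym (conj Ax mx).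
  by rewrite -lE; exact: subIsetr.
have dl t : l (d + t *: v).
  move: mx; rewrite lE => -[t' _ xE]; exists (t' - tau + t) => //.
  have -> : d = u + p + t' *: v - tau *: v by rewrite xE -tauE subKr.
  by rewrite scalerDl scalerBl !addrA.
have Ad t : A (d + t *: v) <-> form theta M (d - c + t *: v) (d - c + t *: v) <= 1.
  rewrite {1}AE; split=> [[y /= qy] ycE|qy].
    by rewrite addrAC -ycE addrC addKr.
  by exists (d - c + t *: v) => //; rewrite addrA subrKC.
pose h := form theta M (d - c) v.
have dE : form theta M d v = form theta M c v + h by rewrite -formDl subrKC.
rewrite dE; apply/eqP; rewrite -subr_eq0 [X in X - _]addrC addrK; apply: contraT => h0.
pose alpha := h / form theta M v v.
have a0 : alpha != 0 by rewrite mulf_neq0 // invr_eq0 gt_eqF.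
pose k := d - c - alpha *: v.
have kv : form theta M k v = 0.
  by rewrite /k -scaleNr formDl formZl -/h mulNr divfK ?subrr // gt_eqF.
have qk t : form theta M (d - c + t *: v) (d - c + t *: v) =
    form theta M k k + `|alpha + t| ^+ 2 * form theta M v v.
  have -> : d - c + t *: v = k + (alpha + t) *: v.
    by rewrite scalerDl addrA subrK.
  rewrite -form_sqZ; apply: pythagoras; first by rewrite formZr kv mulr0.
  by rewrite formZl form_conj ?mulr0.
have kk1 : form theta M k k <= 1.
  have : A (d + tau *: v) by rewrite -tauE subrKC.
  move/Ad; rewrite qk; apply: le_trans.
  by rewrite lerDl mulr_ge0 ?exprn_ge0 // ltW.
have kk0 : 0 <= 1 - form theta M k k by rewrite subr_ge0.
(* [rho] is the radius of the disk, [k] the foot of the perpendicular from the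
   center, and [d + t *: v] its boundary point opposite to [d]. *)
have [rho rho0 rhoE] := sqrtE (divr_ge0 kk0 (ltW qv)).
have na0 : `|alpha| != 0 by rewrite normr_eq0.
pose e := alpha / `|alpha|.
have e1 : `|e| = 1 by rewrite normrM normfV normr_id mulfV.
have aE : alpha = e * `|alpha| by rewrite divfK.
pose t := - (e * rho) - alpha.
have At : A (d + t *: v).
  apply/Ad; rewrite qk /t subrKC normrN normrM e1 mul1r ger0_norm // rhoE.
  by rewrite divfK ?gt_eqF // subrKC.
have N1 : `|-1 : K| = 1 by rewrite normrN1.
have [+ _] := symmetric_atP dsym (conj At (dl t)) N1.
rewrite [d + t *: v]addrC addrK scalerA mulN1r => /Ad; rewrite qk.
have -> : alpha - t = e * (2 * `|alpha| + rho).
  by rewrite /t mulrDr mulrCA -aE; ring.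
have a2 : 0 < 2 * `|alpha| by rewrite mulr_gt0 // normr_gt0.
rewrite normrM e1 mul1r ger0_norm ?addr_ge0 ?(ltW a2) //.
rewrite -lerBrDl -ler_pdivlMr // -rhoE ler_pXn2r ?nnegrE ?addr_ge0 ?(ltW a2) //.
by rewrite gerDr => /(lt_le_trans a2); rewrite ltxx.
Qed.
End Ellipsoids.

(** * The real case *)

Section Reflections.
Variables (K : fieldType) (n : nat).

(** The linear part of a reflection: the kernel of [phi] is fixed, and [v] is
    multiplied by [z] when [v *m phi = 1]. *)
Definition refl_mx (phi : 'cV[K]_n) (v : 'rV[K]_n) (z : K) : 'M[K]_n :=
  1%:M + (z - 1) *: (phi *m v).

Lemma mul_refl_mx phi v z x :
  x *m refl_mx phi v z = x + ((z - 1) * (x *m phi) 0 0) *: v.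
Proof.
rewrite mulmxDr mulmx1 -scalemxAr mulmxA [x *m phi in LHS]mx11_scalar mul_scalar_mx.
by rewrite scalerA.
Qed.

Lemma mulmx_row_inj (A B : 'M[K]_n) : (forall x : 'rV_n, x *m A = x *m B) -> A = B.
Proof. by move=> AB; apply/row_matrixP => i; rewrite !rowE. Qed.

Lemma refl_mxV phi v z : (v *m phi) 0 0 = 1 -> z != 0 ->
  refl_mx phi v z *m refl_mx phi v z^-1 = 1%:M.
Proof.
move=> vphi z0; apply: mulmx_row_inj => x; rewrite mulmxA mulmx1 !mul_refl_mx.
rewrite -addrA mulmxDl -scalemxAl [in X in _ + (_ + X)]mxE.
rewrite [X in _ * (_ + X)]mxE vphi mulr1 -scalerDl -[RHS]addr0; congr (_ + _).
apply/eqP; rewrite scaler_eq0; apply/orP; left.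
by apply/eqP; field.
Qed.

Lemma refl_fixed phi v s c : (2 : K) != 0 -> v != 0 ->
  c *m refl_mx phi v (-1) + - ((-1 - 1) * s) *: v = c -> (c *m phi) 0 0 = s.
Proof.
move=> two0 v0; rewrite mul_refl_mx -addrA -scalerDl => /eqP.
rewrite -[X in _ == X]addr0 (inj_eq (addrI c)) scaler_eq0 (negPf v0) orbF.
rewrite -mulrBr mulf_eq0 => /orP[|]; last by rewrite subr_eq0 => /eqP.
by rewrite -opprD oppr_eq0 (negPf two0).
Qed.
End Reflections.

Section RealCase.
Variables (R : realType).

Lemma quad_max m (B : set 'rV[R]_m) (M : 'M[R]_m) c : compact B -> B !=set0 ->
  exists2 a, B a & forall x, B x -> quad M (x - c) <= quad M (a - c).
Proof.
move=> cB B0.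
have : {within B, continuous (fun x : 'rV[R]_m => quad M (x - c))}.
  apply: continuous_subspaceT.
  have cD : mx_continuous (fun x : 'rV[R]_m => x - c).
    move=> i j.
    have -> : (fun x : 'rV[R]_m => (x - c) i j) = (fun x => x i j - c i j).
      by apply/funext => x; rewrite 2!mxE.
    move=> x; apply: cvgB; first exact: nbhs_filter.
      exact: coord_continuous.
    exact: cst_continuous.
  apply: mx_continuous_mul; last exact: mx_continuous_tr.
  by apply: mx_continuous_mul; [exact: cD|exact: mx_continuous_cst].
case/(compact_EVT_max B0 cB) => a; rewrite inE => Ba amax.
by exists a => // x Bx; apply: amax; rewrite inE.
Qed.

Lemma form_idfun n (M : 'M[R]_n) x : form idfun M x x = quad M x.
Proof. by rewrite /form map_mx_id. Qed.

Lemma real_thetaE (t : R) : t * idfun t = `|t| ^+ 2.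
Proof. by rewrite -expr2 real_normK ?num_real. Qed.

Lemma real_sqrtE (a : R) : 0 <= a -> exists2 t : R, 0 <= t & t ^+ 2 = a.
Proof. by move=> a0; exists (Num.sqrt a); rewrite ?sqrtr_ge0 ?sqr_sqrtr. Qed.

Lemma real_puck_ellipsoid n (A : set 'rV[R]_n) : (0 < n)%N -> real_puck A ->
  (ellipsoid idfun A <-> hyperplanar_centers A).
Proof.
move=> n0 [cA nf Ar]; split.
  by apply: hyperplanar_centers_of_ellipsoid; [exact: real_thetaE|exact: real_sqrtE].
move=> Ah; have [c [M [[MT Mpos] inv]]] := invariant_ellipsoid n0 cA nf.
have [a Aa amax] := quad_max M c cA (nonflat_nonempty n0 nf).
apply: (@ellipsoid_of_reflections R idfun n real_thetaE real_sqrtE M c a) => //.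
- by apply/is_hermitianmxP; rewrite expr0 scale1r map_mx_id.
- by move=> x /Mpos; rewrite form_idfun.
- move=> v v0; have [phi [s [vphi Arefl]]] := section_reflection Ar Ah nf v0.
  exists phi, s.
  have reflA z x : `|z| = 1 -> A x -> A (x *m refl_mx phi v z + - ((z - 1) * s) *: v).
    move=> z1 /(Arefl _ _ z1); rewrite mul_refl_mx -addrA -scalerDl.
    by rewrite mulrBr.
  have z0 (z : R) : `|z| = 1 -> z != 0.
    by move=> z1; rewrite -normr_eq0 z1 oner_eq0.
  have inv_z z : `|z| = 1 -> c *m refl_mx phi v z + - ((z - 1) * s) *: v = c /\
      refl_mx phi v z *m M *m (refl_mx phi v z)^T = M.
    move=> z1; apply: (inv _ _ _ _ (refl_mxV vphi (z0 z z1))).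
      by move=> x; exact: reflA.
    by move=> x; apply: reflA; rewrite normfV z1 invr1.
  have N1 : `|-1 : R| = 1 by rewrite normrN1.
  split=> // [|z z1].
    by apply: refl_fixed (proj1 (inv_z _ N1)); rewrite ?pnatr_eq0.
  split=> x; first exact: Arefl.
  rewrite /= !form_idfun -mul_refl_mx.
  by rewrite -quad_congr (proj2 (inv_z _ z1)).
- by move=> x y t Ax Ay; exact: round_sections_convex.
- apply/eqP => ac; apply: nf; apply: (flat_sub_set1 (c := c)) => // x Ax.
  have := amax x Ax; rewrite ac subrr {2}/quad !mul0mx mxE.
  have [/eqP|/Mpos] := eqVneq (x - c) 0; first by rewrite subr_eq0 => /eqP.
  by rewrite ltNge /quad => /negP.
- by move=> x Ax; rewrite !form_idfun; exact: amax.
Qed.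
End RealCase.

(** * Complex space as a real space *)

Section Topology.
Variables (R : realType).

Lemma mx_continuous_continuous (T : topologicalType) p q (F : T -> 'M[R]_(p, q)) :
  mx_continuous F -> continuous F.
Proof.
move=> Fc v S [P FP PS].
have : nbhs v [set w | forall i j, P i j (F w i j)].
  apply: (@filter_forall _ _ _ _ (nbhs_filter v)) => i.
  apply: (@filter_forall _ _ _ _ (nbhs_filter v)) => j.
  exact: (Fc i j v _ (FP i j)).
by apply: (@filterS _ _ (nbhs_filter v)) => w Pw; exact: PS.
Qed.

Lemma Re_continuous : continuous (fun z : (R[i] : numFieldType) => complex.Re z).
Proof.
move=> z S /(nbhs_ballP (complex.Re z))[e /= e0 eS].
apply/nbhs_ballP; exists e%:C%C; first by rewrite /= ltcR.
move=> w zw; have {}zw : `|z - w| < e%:C%C by exact: zw.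
apply: eS; rewrite -ball_normE /=.
rewrite -ltcR; apply: le_lt_trans zw.
by rewrite -raddfB; exact: normc_ge_Re.
Qed.

Lemma Im_continuous : continuous (fun z : (R[i] : numFieldType) => complex.Im z).
Proof.
move=> z S /(nbhs_ballP (complex.Im z))[e /= e0 eS].
apply/nbhs_ballP; exists e%:C%C; first by rewrite /= ltcR.
move=> w zw; have {}zw : `|z - w| < e%:C%C by exact: zw.
apply: eS; rewrite -ball_normE /=.
rewrite -ltcR; apply: le_lt_trans zw.
rewrite -raddfB -normrN -ReiNIm; apply: le_trans (normc_ge_Re _) _.
by rewrite normrM complexiE normCi mulr1.
Qed.

Lemma real_coords_continuous n :
  continuous (@real_coords R n : 'rV[(R[i] : numFieldType)]_n -> 'rV[R]_(n + n)).
Proof.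
apply: mx_continuous_continuous => i j.
case: (split_ordP j) => k ->.
  have -> : (fun v : 'rV[(R[i] : numFieldType)]_n => real_coords v i (lshift n k)) =
      (fun z : (R[i] : numFieldType) => complex.Re z) \o (fun v => v i k).
    by apply/funext => v; rewrite /real_coords row_mxEl mxE.
  move=> v; apply: continuous_comp; first exact: coord_continuous.
  exact: Re_continuous.
have -> : (fun v : 'rV[(R[i] : numFieldType)]_n => real_coords v i (rshift n k)) =
    (fun z : (R[i] : numFieldType) => complex.Im z) \o (fun v => v i k).
  by apply/funext => v; rewrite /real_coords row_mxEr mxE.
move=> v; apply: continuous_comp; first exact: coord_continuous.
exact: Im_continuous.
Qed.
End Topology.

Section RealCoords.
Variables (R : realType) (n : nat).
Local Notation Rc := (@complex.Re R).
Local Notation Ic := (@complex.Im R).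
Implicit Types x y : 'rV[R[i]]_n.

Definition of_real_coords (w : 'rV[R]_(n + n)) : 'rV[R[i]]_n :=
  \row_j (Complex (lsubmx w 0 j) (rsubmx w 0 j)).

Lemma real_coordsK : cancel (@real_coords R n) of_real_coords.
Proof.
move=> x; apply/rowP => j; rewrite mxE /real_coords row_mxKl row_mxKr !mxE.
by case: (x 0 j).
Qed.

Lemma of_real_coordsK : cancel of_real_coords (@real_coords R n).
Proof.
move=> w; rewrite -[RHS]hsubmxK /real_coords; congr row_mx;
  by apply/rowP => j; rewrite !mxE.
Qed.

Lemma real_coordsD x y : real_coords (x + y) = real_coords x + real_coords y.
Proof.
rewrite /real_coords add_row_mx.
by congr row_mx; apply/rowP => j; rewrite !mxE raddfD.
Qed.

Lemma real_coordsB x y : real_coords (x - y) = real_coords x - real_coords y.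
Proof. by apply/eqP; rewrite eq_sym subr_eq -real_coordsD subrK. Qed.

(** The real matrix of the complex linear map [L] in the coordinates
    [real_coords]. *)
Definition realify m (L : 'M[R[i]]_(n, m)) : 'M[R]_(n + n, m + m) :=
  block_mx (map_mx Rc L) (map_mx Ic L) (- map_mx Ic L) (map_mx Rc L).

Lemma real_coords_mul m (L : 'M[R[i]]_(n, m)) x :
  real_coords (x *m L) = real_coords x *m realify L.
Proof.
rewrite /real_coords mul_row_block; congr row_mx; apply/rowP => j; rewrite !mxE.
  rewrite raddf_sum -big_split /=; apply: eq_bigr => k _; rewrite !mxE.
  by case: (x 0 k) => a b; case: (L k j) => c d /=; rewrite mulrN.
rewrite raddf_sum -big_split /=; apply: eq_bigr => k _; rewrite !mxE.
by case: (x 0 k) => a b; case: (L k j) => c d /=.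
Qed.
End RealCoords.

(** * The complex case *)

(** Polarization, applied to the vectors of the canonical basis. *)
Lemma quad_inj (R : numFieldType) n (P Q : 'M[R]_n) : P^T = P -> Q^T = Q ->
  (forall x, quad P x = quad Q x) -> P = Q.
Proof.
move=> PT QT PQ; apply/matrixP => i j.
have entry (S : 'M[R]_n) : S i j = (('e_i : 'rV_n) *m S *m ('e_j : 'rV_n)^T) 0 0.
  by rewrite -rowE trmx_delta -colE !mxE.
have := PQ ('e_i + 1 *: 'e_j); rewrite !quad_line // -!entry !PQ => /addIr/addrI.
by rewrite mulr1; apply: mulfI; rewrite pnatr_eq0.
Qed.

Section ComplexCase.
Variables (R : realType) (n : nat).
Local Notation rc := (real_complex R).

Lemma realifyV (L L' : 'M[R[i]]_n) :
  L *m L' = 1%:M -> realify L *m realify L' = 1%:M.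
Proof.
move=> LL'; apply: mulmx_row_inj => w.
rewrite -(of_real_coordsK w) mulmxA -!real_coords_mul -mulmxA LL'.
by rewrite !mulmx1.
Qed.

(** A complex hyperplane is contained in the real hyperplane given by the real
    part of its equation. *)
Lemma flat_real_coords (A : set 'rV[R[i]]_n) :
  flat A -> flat [set real_coords x | x in A].
Proof.
move=> [H /hyperplane_sub_level[phi [s phi0 Hs]] AH].
pose psi := col_mx (map_mx (@complex.Re R) phi) (- map_mx (@complex.Im R) phi).
exists [set w | (w *m psi) 0 0 = complex.Re s].
  apply: hyperplane_level; apply: contra_neq phi0.
  rewrite -[X in _ = X](@col_mx0 _ n n) => /eq_col_mx[/colP re0 /colP im0].
  apply/colP => j; have := re0 j; have := im0 j; rewrite !mxE => /eqP.
  by rewrite oppr_eq0 => /eqP; case: (phi j 0) => a b /= -> ->.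
move=> _ [x /AH/Hs <- <-] /=.
have := real_coords_mul phi x; rewrite /realify {2}/real_coords mul_row_block.
rewrite /psi {2}/real_coords mul_row_col => /eq_row_mx[/matrixP/(_ 0 0) + _].
by rewrite mxE => ->.
Qed.

(** In blocks, invariance under multiplication by [i] says that the two diagonal
    blocks of [M] agree and that the off-diagonal block [Q] is skew, so that
    [P + i Q] is Hermitian. *)
Lemma complex_form_of_real (M : 'M[R]_(n + n)) : M^T = M ->
  (forall x : 'rV[R[i]]_n, quad M (real_coords ('i *: x)) = quad M (real_coords x)) ->
  exists2 H : 'M[R[i]]_n, H \is hermitianmx n false Num.conj &
    forall x, form Num.conj H x x = (quad M (real_coords x))%:C%C.
Proof.
move=> MT Mi.
pose J := realify ('i%:M : 'M[R[i]]_n).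
have JE : J = block_mx 0 1%:M (- 1%:M) 0.
  have re : map_mx (@complex.Re R) ('i%:M : 'M[R[i]]_n) = 0.
    apply/matrixP => j k; rewrite !mxE -complexiE; by case: eqP.
  have im : map_mx (@complex.Im R) ('i%:M : 'M[R[i]]_n) = 1%:M.
    apply/matrixP => j k; rewrite !mxE -complexiE; by case: eqP.
  by rewrite /J /realify re im.
have JMJ : J *m M *m J^T = M.
  apply: quad_inj => //; first by rewrite !trmx_mul trmxK MT mulmxA.
  move=> w; rewrite quad_congr -(of_real_coordsK w) -real_coords_mul.
  by rewrite mul_mx_scalar Mi.
pose P := ulsubmx M; pose Q := ursubmx M; pose S := drsubmx M.
have ME : M = block_mx P Q Q^T S by rewrite /Q trmx_ursub MT submxK.
have PT : P^T = P by rewrite /P trmx_ulsub MT.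
have N1T : (- 1%:M : 'M[R]_n)^T = - 1%:M by rewrite linearN /= trmx1.
have JT : J^T = block_mx 0 (- 1%:M) 1%:M 0.
  by rewrite JE tr_block_mx N1T !trmx0 trmx1.
move: JMJ; rewrite JT JE {1}ME !mulmx_block.
rewrite !(mulmx0, mul0mx, mulmx1, mul1mx, addr0, add0r, mulNmx, mulmxN).
rewrite [RHS]ME => /eq_block_mx[SP QN _ _].
have QT : Q^T = - Q by rewrite -[in RHS]QN opprK.
exists (map_mx rc P + 'i *: map_mx rc Q).
  apply/is_hermitianmxP; rewrite expr0 scale1r.
  apply/matrixP => j k; have := congr1 (fun X : 'M[R]_n => X j k) PT.
  have := congr1 (fun X : 'M[R]_n => X j k) QT; rewrite !mxE => -> ->.
  by rewrite -complexiE; simpc.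
move=> x; have := hermitian_form_split x PT QT; rewrite /form => ->.
rewrite mxE; congr (_%:C)%C.
rewrite /quad ME /real_coords mul_row_block tr_row_mx mul_row_col.
rewrite SP; move: (map_mx _ x) (map_mx _ x) => b a.
rewrite !mulmxDl QT mulmxN mulNmx -(skew_formC a b QT).
rewrite scaler_nat mulr2n; move: (_ *m a^T) (_ *m b^T) (_ *m b^T) => X Y Z.
by rewrite !mxE; ring.
Qed.

Lemma complex_thetaE (t : R[i]) : t * Num.conj t = `|t| ^+ 2.
Proof. by rewrite normCK. Qed.

Lemma complex_sqrtE (a : R[i]) : 0 <= a -> exists2 t : R[i], 0 <= t & t ^+ 2 = a.
Proof. by move=> a0; exists (sqrtC a); rewrite ?sqrtC_ge0 ?sqrtCK. Qed.

Lemma complex_puck_ellipsoid (A : set 'rV[R[i]]_n) : (0 < n)%N -> complex_puck A ->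
  (ellipsoid Num.conj A <-> hyperplanar_centers A).
Proof.
move=> n0 [cA nfB Ar]; split.
  apply: hyperplanar_centers_of_ellipsoid; first exact: complex_thetaE.
  exact: complex_sqrtE.
move=> Ah; pose B := [set real_coords x | x in A].
have nf : ~ flat A by move=> /flat_real_coords.
have n20 : (0 < n + n)%N by rewrite addn_gt0 n0.
have cB : compact B.
  apply: continuous_compact cA.
  by apply: continuous_subspaceT; exact: real_coords_continuous.
have [cR [M [[MT Mpos] inv]]] := invariant_ellipsoid n20 cB nfB.
pose c := of_real_coords cR.
have cRE : cR = real_coords c by rewrite of_real_coordsK.
have [_ [a Aa <-] amax] := quad_max M cR cB (nonflat_nonempty n20 nfB).
have refl v : v != 0 -> exists (phi : 'cV[R[i]]_n) (s : R[i]),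
    [/\ (v *m phi) 0 0 = 1, (c *m phi) 0 0 = s &
      forall z, `|z| = 1 ->
        (forall x, A x -> A (x + ((z - 1) * ((x *m phi) 0 0 - s)) *: v)) /\
        (forall x, quad M (real_coords (x + ((z - 1) * (x *m phi) 0 0) *: v)) =
           quad M (real_coords x))].
  move=> v0; have [phi [s [vphi Arefl]]] := section_reflection Ar Ah nf v0.
  exists phi, s.
  have reflB z w : `|z| = 1 -> B w ->
      B (w *m realify (refl_mx phi v z) + real_coords (- ((z - 1) * s) *: v)).
    move=> z1 [x Ax <-]; rewrite -real_coords_mul -real_coordsD.
    exists (x *m refl_mx phi v z + - ((z - 1) * s) *: v) => //.
    by have := Arefl _ _ z1 Ax; rewrite mul_refl_mx -addrA -scalerDl mulrBr.
  have z0 (z : R[i]) : `|z| = 1 -> z != 0.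
    by move=> z1; rewrite -normr_eq0 z1 oner_eq0.
  have inv_z z : `|z| = 1 -> c *m refl_mx phi v z + - ((z - 1) * s) *: v = c /\
      realify (refl_mx phi v z) *m M *m (realify (refl_mx phi v z))^T = M.
    pose b y := real_coords (- ((y - 1) * s) *: v).
    move=> z1; have [||fix_c invM] :=
      inv _ (b z) _ (b z^-1) (realifyV (refl_mxV vphi (z0 z z1))).
    - by move=> w; exact: reflB.
    - by move=> w; apply: reflB; rewrite normfV z1 invr1.
    split=> //; apply: (can_inj (@real_coordsK R n)).
    by rewrite real_coordsD real_coords_mul -cRE.
  have N1 : `|-1 : R[i]| = 1 by rewrite normrN1.
  split=> // [|z z1].
    by apply: refl_fixed (proj1 (inv_z _ N1)); rewrite ?pnatr_eq0.
  split=> x; first exact: Arefl.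
  by rewrite -mul_refl_mx real_coords_mul -quad_congr (proj2 (inv_z _ z1)).
have [x|H Hh HE] := complex_form_of_real MT.
  have [->|x0] := eqVneq x 0; first by rewrite scaler0.
  have [phi [s [xphi _ zA]]] := refl _ x0.
  have [_ /(_ x) <-] := zA _ (normCi _).
  by rewrite xphi mulr1 scalerBl scale1r subrKC.
have real_coords0 : real_coords (0 : 'rV[R[i]]_n) = 0.
  by apply: (addrI (real_coords 0)); rewrite -real_coordsD !addr0.
apply: (@ellipsoid_of_reflections _ Num.conj n complex_thetaE complex_sqrtE H c a) => //.
- move=> x x0; rewrite HE ltcR; apply: Mpos; apply: contra_neq x0.
  by rewrite -real_coords0; exact: (can_inj (@real_coordsK R n)).
- move=> v v0; have [phi [s [vphi cs zA]]] := refl v v0; exists phi, s; split=> // z z1.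
  have [Az qz] := zA z z1; split=> // x.
  by rewrite /= !HE qz.
- by move=> x y t Ax Ay; exact: round_sections_convex.
- apply/eqP => ac; apply: nfB; apply: (flat_sub_set1 (c := cR)) => // w Bw.
  have := amax w Bw; rewrite ac cRE subrr {2}/quad !mul0mx mxE.
  have [/eqP|/Mpos] := eqVneq (w - real_coords c) 0; first by rewrite subr_eq0 => /eqP.
  by rewrite ltNge /quad => /negP.
- move=> x Ax; rewrite !HE lecR !real_coordsB -cRE; apply: amax; by exists x.
Qed.
End ComplexCase.

(** * Characterization of ellipsoids *)

Theorem theorem10 (R : realType) (n : nat) (n_gt0 : (0 < n)%N) :
  (forall A : set 'rV[R]_n, real_puck A ->
     (ellipsoid idfun A <-> hyperplanar_centers A)) /\
  (forall A : set 'rV[R[i]]_n, complex_puck A ->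
     (ellipsoid Num.conj A <-> hyperplanar_centers A)).
Proof.
by split=> A pA; [exact: real_puck_ellipsoid|exact: complex_puck_ellipsoid].
Qed.
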